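(* In the setting described in the context, suppose that, on a neighborhood of $\mathcal X$, the response map $y$ is continuous piecewise affine over a finite polyhedral partition $\{\mathcal R_i\}_{i=1}^N$, namely $$y(u)=A_iu+b_i,\qquad u\in\mathcal R_i .$$ Let $I(x)=\{i:x\in\overline{\mathcal R_i}\}$ and $I_\delta(x)=\{i:\mathcal R_i\cap B_\delta(x)\neq\emptyset\}$. Then $$\mathrm J^cy(x)=\operatorname{conv}\{A_i:i\in I(x)\},\qquad \mathrm Jy_\delta(x)\in\operatorname{conv}\{A_i:i\in I_\delta(x)\}.$$ Consequently, $$g_\delta(x)\in d_x(x)+\operatorname{conv}\{A_i^\top d_y(x):i\in I_\delta(x)\}.$$ If $x$ is $\delta$-regular, i.e. $I_\delta(x)\subseteq I(x)$, then $\omega_y^c(x,\delta)=0$ and $g_\delta(x)\in\partial^c\tilde\varphi(x)$, which means that the approximate hypergradient $g_\delta(x)$ exactly belongs to the Clarke chain-rule subdifferential $\partial^c\tilde\varphi(x)$: $$\operatorname{dist}\big(g_\delta(x),\partial^c\tilde\varphi(x)\big)=0.$$ Moreover, if $x$ lies in the interior of a single affine cell $\mathcal R_{i_x}$, then for every $0<\delta<\operatorname{dist}(x,\mathbb R^n\setminus\mathcal R_{i_x})$, $$g_\delta(x)=d_x(x)+A_{i_x}^\top d_y(x)=\nabla\tilde\varphi(x).$$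
   Context: $\|\cdot\|$ is the Euclidean norm for vectors and the corresponding operator norm for matrices; $\operatorname{dist}(z,\mathcal S)=\inf_{s\in\mathcal S}\|z-s\|$; $\mathbb B_n$ is the closed unit ball of $\mathbb R^n$; $B_\delta(x)=\{s:\|s-x\|\le\delta\}$. Throughout, $x\in\mathcal X$, and all smoothing radii satisfy $0<\delta\le\bar\delta$. Response mapping. $\mathcal X\subset\mathbb R^n$ is nonempty, convex and compact, and $\mathcal N$ is an open neighborhood of $\mathcal X$. For each $x\in\mathcal N$ the lower-level solution set $\arg\min_{\xi\in\mathcal Y}g(x,\xi)$ (with $\mathcal Y\subseteq\mathbb R^m$) is a singleton $\{y(x)\}$, and the response map $y:\mathcal N\to\mathbb R^m$ is locally Lipschitz. A number $\bar\delta>0$ with $\mathcal X+\bar\delta\mathbb B_n\subseteq\mathcal N$ is fixed; on $\mathcal X+\bar\delta\mathbb B_n$, $y$ is bounded and $L_y$-Lipschitz. Smoothing. $y_\delta(u)=\mathbb E_{\xi\sim\mathrm{Unif}(\mathbb B_n)}[y(u+\delta\xi)]$, with Jacobian $\mathrm Jy_\delta(u)\in\mathbb R^{m\times n}$. Upper-level objective. $\varphi\in C^1(\mathbb R^n\times\mathbb R^m)$ with partial gradients $\nabla_1\varphi$ (in the first argument) and $\nabla_2\varphi$ (in the second). There are finite constants $L_{1x},L_{1y},L_{2x},L_{2y},M_y>0$ such that, for all relevant pairs $(x,y),(x',y')$ at which these gradients are evaluated, $\|\nabla_1\varphi(x,y)-\nabla_1\varphi(x',y')\|\le L_{1x}\|x-x'\|+L_{1y}\|y-y'\|$,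 $\|\nabla_2\varphi(x,y)-\nabla_2\varphi(x',y')\|\le L_{2x}\|x-x'\|+L_{2y}\|y-y'\|$, and $\|\nabla_2\varphi(x,y)\|\le M_y$. Derived objects. $\tilde\varphi(x)=\varphi(x,y(x))$, $d_x(x)=\nabla_1\varphi(x,y(x))$, $d_y(x)=\nabla_2\varphi(x,y(x))$, and the Bi-ZOL approximate hypergradient is $g_\delta(x)=d_x(x)+\mathrm Jy_\delta(x)^\top d_y(x)$. Clarke objects. For a locally Lipschitz map $F$ on an open set, differentiable on the full-measure set $\Omega_F$, the Clarke generalized Jacobian is $\mathrm J^cF(x)=\operatorname{conv}\{\lim_k \mathrm JF(x^k): x^k\to x,\ x^k\in\Omega_F\}$; for a scalar locally Lipschitz function $f$, the Clarke subdifferential is $\partial^cf(x)=\operatorname{conv}\{\lim_k\nabla f(x^k):x^k\to x,\ x^k\in\Omega_f\}$. Local set variation: $\omega_y^c(x,\delta)=\sup_{\|s-x\|\le\delta}\ \sup_{V\in\mathrm J^cy(s)}\operatorname{dist}(V,\mathrm J^cy(x))$.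
   Formalization: The claims on smoothing are stated for radii such that the ball B_δ(x) lies in the neighborhood of X on which y is piecewise affine (they fail otherwise), and the cells of the partition are taken to be closed polyhedra with nonempty, pairwise disjoint interiors. *)

(* Defs.v *)
From HB Require Import structures.
From mathcomp Require Import all_boot all_order all_algebra.
From mathcomp Require Import all_classical all_reals all_analysis.

Set Implicit Arguments.
Unset Strict Implicit.
Unset Printing Implicit Defensive.

Import Order.TTheory GRing.Theory Num.Theory.
Import numFieldNormedType.Exports.

Local Open Scope classical_set_scope.
Local Open Scope ring_scope.

(* Vectors of R^n are column vectors 'cV[R]_n.  The canonical norm of the
   library on matrices is the sup norm; it is only used through the topology
   and the notion of differentiability that it induces.  All metric quantities
   are expressed with the Euclidean norm [enorm] and the operator norm
   [opnorm]. *)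

Section euclidean.
Context {R : realType}.

Definition enorm n (v : 'cV[R]_n) : R := Num.sqrt (\sum_i v i 0 ^+ 2).

Definition opnorm m n (A : 'M[R]_(m, n)) : R :=
  sup [set enorm (A *m v) | v in [set v : 'cV[R]_n | enorm v <= 1]].

Definition eball n (x : 'cV[R]_n) (r : R) : set 'cV[R]_n :=
  [set s | enorm (s - x) <= r].

(* Extended-real valued: the distance to the empty set is +oo. *)
Definition dist (E : zmodType) (nrm : E -> R) (z : E) (S : set E) : \bar R :=
  ereal_inf [set (nrm (z - s))%:E | s in S].

Definition conv_hull (E : lmodType R) (S : set E) : set E :=
  [set v | exists (k : nat) (w : 'I_k -> R) (a : 'I_k -> E),
    [/\ forall j, 0 <= w j, \sum_j w j = 1, forall j, S (a j)
      & v = \sum_j w j *: a j]].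

Definition locally_lipschitz n m (D : set 'cV[R]_n)
    (f : 'cV[R]_n -> 'cV[R]_m) : Prop :=
  forall x, D x -> exists (L : R) (V : set 'cV[R]_n),
    nbhs x V /\
    forall u v, (V `&` D) u -> (V `&` D) v ->
      enorm (f u - f v) <= L * enorm (u - v).

End euclidean.

Section derivatives.
Context {R : realType}.

(* Matrix of the differential in the canonical bases, acting on column vectors:
   the transpose of the library's ['J], which acts on row vectors. *)
Definition Jac n m (f : 'cV[R]_n -> 'cV[R]_m) (x : 'cV[R]_n) : 'M[R]_(m, n) :=
  \matrix_(i, j) ('d f x (delta_mx j 0 : 'cV[R]_n)) i 0.

Definition grad n (f : 'cV[R]_n -> R) (x : 'cV[R]_n) : 'cV[R]_n :=
  \col_j 'd f x (delta_mx j 0 : 'cV[R]_n).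

Definition grad1 n m (phi : 'cV[R]_n -> 'cV[R]_m -> R) x y : 'cV[R]_n :=
  grad (fun x' => phi x' y) x.

Definition grad2 n m (phi : 'cV[R]_n -> 'cV[R]_m -> R) x y : 'cV[R]_m :=
  grad (phi x) y.

(* In finite dimension, continuity of p |-> 'd F p amounts to continuity of
   p |-> 'd F p v for every fixed v. *)
Definition C1 (V : normedModType R) (F : V -> R) : Prop :=
  (forall p, differentiable F p) /\
  (forall v, continuous (fun p => 'd F p v)).

(* If F is only meaningful on an open set containing x, its values elsewhere do
   not matter: u @ \oo --> x forces the u k to be eventually in that set. *)
Definition clarke_Jac n m (F : 'cV[R]_n -> 'cV[R]_m) (x : 'cV[R]_n)
    : set 'M[R]_(m, n) :=
  conv_hull [set V : 'M[R]_(m, n) | exists u : nat -> 'cV[R]_n,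
    [/\ forall k, differentiable F (u k), u @ \oo --> x
      & (fun k => Jac F (u k)) @ \oo --> V]].

Definition clarke_subdiff n (f : 'cV[R]_n -> R) (x : 'cV[R]_n)
    : set 'cV[R]_n :=
  conv_hull [set v : 'cV[R]_n | exists u : nat -> 'cV[R]_n,
    [/\ forall k, differentiable f (u k), u @ \oo --> x
      & (fun k => grad f (u k)) @ \oo --> v]].

Definition clarke_variation n m (F : 'cV[R]_n -> 'cV[R]_m)
    (x : 'cV[R]_n) (delta : R) : \bar R :=
  ereal_sup [set ereal_sup [set dist (@opnorm R m n) V (clarke_Jac F x)
                           | V in clarke_Jac F s]
            | s in eball x delta].

End derivatives.

Section lebesgue.
Context {R : realType}.
Local Notation mR := (measurableTypeR R).

Definition tcons n (p : mR * n.-tuple mR) : n.+1.-tuple mR :=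
  [tuple of p.1 :: p.2].

Lemma measurable_tcons n : measurable_fun [set: mR * n.-tuple mR] (@tcons n).
Proof. exact: measurable_cons. Qed.

Section step.
Context n (mu : {sigma_finite_measure set (n.-tuple mR) -> \bar R}).

Definition lebesgue_step : set (n.+1.-tuple mR) -> \bar R :=
  pushforward (@lebesgue_measure R \x mu)%E (@tcons n).

Let mu0 : lebesgue_step set0 = 0%E.
Proof. by rewrite /lebesgue_step /pushforward preimage_set0 measure0. Qed.

Let mu_ge0 A : (0 <= lebesgue_step A)%E.
Proof. by rewrite /lebesgue_step /pushforward; exact: measure_ge0. Qed.

Let mu_sigma : semi_sigma_additive lebesgue_step.
Proof.
move=> F mF tF mUF; rewrite /lebesgue_step /pushforward preimage_bigcup.
apply: measure_semi_sigma_additive.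
- by move=> k; rewrite -[X in measurable X]setTI; exact: measurable_tcons.
- apply/trivIsetP => /= i j _ _ ij; rewrite -preimage_setI.
  by move/trivIsetP : tF => /(_ _ _ _ _ ij) ->//; rewrite preimage_set0.
- by rewrite -preimage_bigcup -[X in measurable X]setTI; exact: measurable_tcons.
Qed.

HB.instance Definition _ :=
  isMeasure.Build _ _ _ lebesgue_step mu0 mu_ge0 mu_sigma.

Let tuncons (t : n.+1.-tuple mR) : mR * n.-tuple mR :=
  (thead t, [tuple of behead t]).

Let measurable_tuncons : measurable_fun [set: n.+1.-tuple mR] tuncons.
Proof.
apply/measurable_fun_pairP; split.
  exact: measurable_tnth.
exact: measurable_behead.
Qed.

Let mu_sfin : sigma_finite [set: n.+1.-tuple mR] lebesgue_step.
Proof.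
have /sigma_finiteP[F [TF ndF Foo]] := sigma_finiteT (@lebesgue_measure R).
have /sigma_finiteP[G [TG ndG Goo]] := sigma_finiteT mu.
exists (fun k => tuncons @^-1` (F k `*` G k)).
  rewrite -preimage_bigcup; apply/seteqP; split=> // t _ /=.
  have [i _ Fi] : (\bigcup_i F i) (tuncons t).1 by rewrite -TF.
  have [j _ Gj] : (\bigcup_i G i) (tuncons t).2 by rewrite -TG.
  exists (maxn i j) => //; split.
    by move: Fi; exact/subsetPset/ndF/leq_maxl.
  by move: Gj; exact/subsetPset/ndG/leq_maxr.
move=> k; have [mF Fk] := Foo k; have [mG Gk] := Goo k; split.
  by rewrite -[X in measurable X]setTI; apply: measurable_tuncons => //;
    exact: measurableX.
rewrite /lebesgue_step /pushforward.
have -> : @tcons n @^-1` (tuncons @^-1` (F k `*` G k)) = F k `*` G k.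
  rewrite -comp_preimage; have -> : tuncons \o @tcons n = id; last by [].
  apply/funext => -[a t]; rewrite /tuncons /tcons /= theadE; congr pair.
  exact: val_inj.
by rewrite product_measure1E// lte_mul_pinfty// ge0_fin_numE.
Qed.

HB.instance Definition _ :=
  Measure_isSigmaFinite.Build _ _ _ lebesgue_step mu_sfin.

End step.

(* n-dimensional Lebesgue measure on the Borel sets of R^n, as an iterated
   product; see [lebesgue_tuple_box]. *)
Fixpoint lebesgue_tuple n : {sigma_finite_measure set (n.-tuple mR) -> \bar R} :=
  match n with
  | 0 => \d_([tuple] : 0.-tuple mR)
  | n'.+1 => lebesgue_step (lebesgue_tuple n')
  end.

Lemma lebesgue_tuple_box n (A : 'I_n -> set mR) :
  (forall i, measurable (A i)) ->
  lebesgue_tuple n [set t | forall i, A i (tnth t i)] =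
  (\prod_(i < n) (@lebesgue_measure R (A i)))%E.
Proof.
elim: n A => [|n IH] A mA.
  rewrite big_ord0 /= diracE mem_set //= => -[]//.
rewrite big_ord_recl -(IH (fun i => A (lift ord0 i)))//.
rewrite -product_measure1E//; last first.
  rewrite (_ : [set _ | _] = \bigcap_i (fun t => tnth t i) @^-1` A (lift ord0 i)); last first.
    by apply/seteqP; split=> t /= H i; [move=> _; exact: H|exact: (H i I)].
  apply: fin_bigcap_measurable => // i _.
  by rewrite -[X in measurable X]setTI; exact: (measurable_tnth i).
rewrite /= /lebesgue_step /pushforward; congr (_ _).
apply/seteqP; split=> -[x t] /= H.
  split; first by have := H ord0.
  by move=> i; have := H (lift ord0 i); rewrite tnthS.
by move=> i; case: (unliftP ord0 i) => [j|] ->; rewrite ?tnthS; case: H.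
Qed.

Definition col_of_tuple n (t : n.-tuple mR) : 'cV[R]_n := \col_i tnth t i.

(* Expectation of h under the uniform distribution on the closed unit ball. *)
Definition unif_ball_mean n (h : 'cV[R]_n -> R) : R :=
  let B := [set t : n.-tuple mR | eball 0 1 (col_of_tuple t)] in
  (fine (lebesgue_tuple n B))^-1 *
  (\int[lebesgue_tuple n]_(t in B) h (col_of_tuple t)).

Definition smoothing n m (delta : R) (y : 'cV[R]_n -> 'cV[R]_m)
    (u : 'cV[R]_n) : 'cV[R]_m :=
  \col_i unif_ball_mean (fun xi => y (u + delta *: xi) i 0).

End lebesgue.

Section polyhedral.
Context {R : realType}.

Definition polyhedron n (P : set 'cV[R]_n) : Prop :=
  exists (p : nat) (C : 'M[R]_(p, n)) (c : 'cV[R]_p),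
    P = [set u | forall k, (C *m u) k 0 <= c k 0].

(* Cells are closed and full-dimensional, overlap at most along their
   boundaries, and cover U; they may extend beyond U.  The matrix attached to a
   lower-dimensional cell would not be determined by the function, and with
   non-closed cells a ball could touch the closure of a cell it does not meet. *)
Definition polyhedral_partition n k (U : set 'cV[R]_n)
    (cell : 'I_k -> set 'cV[R]_n) : Prop :=
  [/\ forall i, polyhedron (cell i),
      forall i, interior (cell i) !=set0,
      forall i j, i != j -> interior (cell i) `&` interior (cell j) = set0
    & U `<=` \bigcup_i cell i].

Definition continuous_piecewise_affine n m k (U : set 'cV[R]_n)
    (y : 'cV[R]_n -> 'cV[R]_m) (cell : 'I_k -> set 'cV[R]_n)
    (A : 'I_k -> 'M[R]_(m, n)) (b : 'I_k -> 'cV[R]_m) : Prop :=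
  [/\ polyhedral_partition U cell,
      forall u, U u -> {for u, continuous y}
    & forall i u, U u -> cell i u -> y u = A i *m u + b i].

Definition active n k (cell : 'I_k -> set 'cV[R]_n) (x : 'cV[R]_n) : set 'I_k :=
  [set i | closure (cell i) x].

Definition ball_active n k (cell : 'I_k -> set 'cV[R]_n)
    (x : 'cV[R]_n) (delta : R) : set 'I_k :=
  [set i | cell i `&` eball x delta !=set0].

End polyhedral.

Section bilevel.
Context {R : realType} {n m : nat}.
Variables (phi : 'cV[R]_n -> 'cV[R]_m -> R) (y : 'cV[R]_n -> 'cV[R]_m).

Definition argmin_set (Y : set 'cV[R]_m) (h : 'cV[R]_m -> R) : set 'cV[R]_m :=
  [set xi | Y xi /\ forall eta, Y eta -> h xi <= h eta].

Definition phi_tilde (x : 'cV[R]_n) : R := phi x (y x).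
Definition d_x (x : 'cV[R]_n) : 'cV[R]_n := grad1 phi x (y x).
Definition d_y (x : 'cV[R]_n) : 'cV[R]_m := grad2 phi x (y x).

Definition hypergrad (delta : R) (x : 'cV[R]_n) : 'cV[R]_n :=
  d_x x + (Jac (smoothing delta y) x)^T *m d_y x.

End bilevel.

(* Main.v *)
(* At a point of differentiability the Jacobian of [y] is the matrix of any cell
   containing it, and every cell containing [x] contributes interior points
   tending to [x]; hence the limiting Jacobians at [x] are exactly the active
   [A i].  The chain rule turns the same sequences into limiting gradients
   [d_x + (A i)^T d_y] of the upper-level objective.

   For the smoothing, [x + delta *: xi] lies in the interior of some cell for
   almost every [xi], because the cells are bounded by finitely many hyperplanes.
   For such [xi] the increment of [y] along [h] is [A i *m h] as soon as [h] is
   small, and it is always at most [L |h|]; by dominated convergence the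
   smoothing is differentiable, its Jacobian being the average of the [A i]
   weighted by the fractions of the ball lying in the cells. *)

Require Import Defs.
From HB Require Import structures.
From mathcomp Require Import all_boot all_order all_algebra.
From mathcomp Require Import all_classical all_reals all_analysis.
From mathcomp Require Import measurable_realfun.
From mathcomp Require Import ring.

Set Implicit Arguments.
Unset Strict Implicit.
Unset Printing Implicit Defensive.

Import Order.TTheory GRing.Theory Num.Theory.
Import numFieldNormedType.Exports.

Local Open Scope classical_set_scope.
Local Open Scope ring_scope.

(** * Matrix and Euclidean norms *)

Section matrices.
Context {R : realType}.

Lemma cvg_mx (T : Type) (F : set_system T) {FF : Filter F} p q
    (f : T -> 'M[R]_(p, q)) (M : 'M[R]_(p, q)) :
  (forall i j, f t i j @[t --> F] --> M i j) -> f @ F --> M.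
Proof.
move=> fM W [P MP PW]; rewrite /= nbhs_filterE; apply: filterS PW _.
apply: filter_forall => i; apply: filter_forall => j.
exact: (fM i j _ (MP i j)).
Qed.

Lemma mx_entry_le p q (M : 'M[R]_(p, q)) i j : `|M i j| <= `|M|.
Proof.
rewrite [leRHS]/Num.Def.normr/= mx_normrE.
exact: (le_bigmax _ (fun ij => `|M ij.1 ij.2|) (i, j)).
Qed.

Lemma mx_norm_le p q (M : 'M[R]_(p, q)) (c : R) :
  0 <= c -> (forall i j, `|M i j| <= c) -> `|M| <= c.
Proof.
by move=> c0 Mc; rewrite [leLHS]/Num.Def.normr/= mx_normrE bigmax_le// => -[].
Qed.

Lemma mulmx_norm_le p q r (M : 'M[R]_(p, q)) (N : 'M[R]_(q, r)) :
  `|M *m N| <= q%:R * `|M| * `|N|.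
Proof.
apply: mx_norm_le => [|i j]; first by rewrite !mulr_ge0.
rewrite mxE (le_trans (ler_norm_sum _ _ _))//.
have -> : q%:R * `|M| * `|N| = \sum_(k < q) `|M| * `|N|.
  by rewrite sumr_const card_ord -mulrA mulr_natl.
by apply: ler_sum => k _; rewrite normrM ler_pM ?mx_entry_le.
Qed.

Lemma cvg_sumr (V : normedModType R) (T : Type) (F : set_system T)
    {FF : Filter F} (I : Type) (r : seq I) (f : I -> T -> V) (l : I -> V) :
  (forall i, f i t @[t --> F] --> l i) ->
  \sum_(i <- r) f i t @[t --> F] --> \sum_(i <- r) l i.
Proof. by move=> fl; apply: cvg_big => //; exact: add_continuous. Qed.

Lemma mulmx_continuous p q r (M : 'M[R]_(p, q)) :
  continuous (mulmx M : 'M[R]_(q, r) -> 'M[R]_(p, r)).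
Proof.
move=> N; apply: (@cvg_mx _ (nbhs N)) => i j.
under eq_fun do rewrite mxE.
rewrite mxE; apply: cvg_sumr => k.
by apply: cvgMl_tmp; exact: coord_continuous.
Qed.

Lemma continuous_enorm n : continuous (@enorm R n).
Proof.
move=> v; apply: continuous_comp; last exact: sqrt_continuous.
by apply: (@cvg_sumr R _ (nbhs v)) => i; apply: cvgM; exact: coord_continuous.
Qed.

Lemma continuous_enormB n (x : 'cV[R]_n) :
  continuous (fun s : 'cV[R]_n => enorm (s - x)).
Proof.
move=> v; apply: continuous_comp; last exact: continuous_enorm.
by apply: (@cvgB _ _ _ (nbhs v)); [exact: cvg_id|exact: cvg_cst].
Qed.

Lemma enorm_ge0 n (v : 'cV[R]_n) : 0 <= enorm v.
Proof. exact: sqrtr_ge0. Qed.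

Lemma enorm0 n : enorm (0 : 'cV[R]_n) = 0.
Proof. by rewrite /enorm big1 ?sqrtr0// => i _; rewrite mxE expr0n. Qed.

Lemma enormN n (v : 'cV[R]_n) : enorm (- v) = enorm v.
Proof. by congr Num.sqrt; apply: eq_bigr => i _; rewrite mxE sqrrN. Qed.

Lemma enormZ n (c : R) (v : 'cV[R]_n) : enorm (c *: v) = `|c| * enorm v.
Proof.
rewrite /enorm -sqrtr_sqr -sqrtrM ?sqr_ge0// mulr_sumr.
by congr Num.sqrt; apply: eq_bigr => i _; rewrite mxE exprMn.
Qed.

Lemma norm_le_enorm n (v : 'cV[R]_n) : `|v| <= enorm v.
Proof.
apply: mx_norm_le => [|i j]; first exact: enorm_ge0.
rewrite (ord1 j) -sqrtr_sqr ler_wsqrtr// (bigD1 i)//= lerDl.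
by apply: sumr_ge0 => k _; exact: sqr_ge0.
Qed.

(** The sharp factor is the square root of [n]; any constant depending only on the dimension serves
    below. *)
Lemma enorm_le_norm n (v : 'cV[R]_n) : enorm v <= n%:R * `|v|.
Proof.
rewrite -[leRHS]ger0_norm ?mulr_ge0// -sqrtr_sqr ler_wsqrtr//.
apply: (@le_trans _ _ (n%:R * `|v| ^+ 2)).
  rewrite (_ : n%:R * _ = \sum_(i < n) `|v| ^+ 2); last first.
    by rewrite sumr_const card_ord mulr_natl.
  apply: ler_sum => i _.
  by rewrite -[leLHS]real_normK ?num_real// lerXn2r ?nnegrE// mx_entry_le.
rewrite exprMn ler_wpM2r ?exprn_ge0// -natrX ler_nat.
by case: (n) => // k; rewrite -mulnn leq_pmulr.
Qed.

(** Heine-Borel for row vectors, carried over to columns by the continuous transpose [tr]: the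
    preimage of the ball is closed, and it is bounded because the sup norm is below the Euclidean
    norm. *)
Lemma compact_eball n (x : 'cV[R]_n) (r : R) : compact (eball x r).
Proof.
pose tr (v : 'rV[R]_n) : 'cV[R]_n := v^T.
have ctr : continuous tr.
  move=> v; apply: (@cvg_mx _ (nbhs v)) => i j; rewrite /tr mxE.
  by under eq_fun do rewrite mxE; exact: coord_continuous.
have eball_tr : eball x r = tr @` (tr @^-1` eball x r).
  apply/seteqP; split=> [v xv|_ [v xv <-]//].
  by exists v^T; rewrite /= /tr trmxK.
rewrite eball_tr; apply: continuous_compact; first exact: continuous_subspaceT.
apply: bounded_closed_compact; last first.
  apply: (iffLR (continuous_closedP tr) ctr).
  apply: (iffLR (continuous_closedP _) (@continuous_enormB _ x) [set t | t <= r]).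
  exact: closed_le.
exists (`|x| + r); split; first exact: num_real.
move=> M rM v /= vr; apply: le_trans (ltW rM).
apply: (@le_trans _ _ `|tr v|).
  apply: mx_norm_le => // i j.
  by have := mx_entry_le (tr v) j i; rewrite mxE.
by rewrite -lerBlDl (le_trans (lerB_dist _ _))// (le_trans (norm_le_enorm _)).
Qed.

End matrices.

(** * Derivatives of affine pieces *)

Section frechet.
Context {R : realType}.

(** Differentiability by exhibiting the differential: the bound in [e] makes the remainder a
    little-o, and [diff_unique] then identifies ['d f x]. *)
Lemma differentiable_eps (V W : normedModType R) (f : V -> W) (x : V)
    (df : {linear V -> W}) :
  continuous df ->
  (forall e : R, 0 < e ->
     \forall h \near (0 : V), `|f (h + x) - f x - df h| <= e * `|h|) ->
  differentiable f x /\ 'd f x = df :> (V -> W).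
Proof.
move=> cdf fe.
have fx : f \o shift x = cst (f x) + df +o_ (0 : V) id.
  apply/eqaddoP => e e0; near=> h.
  by rewrite /= opprD addrA; near: h; exact: fe.
have dfx := diff_unique cdf fx; split=> //.
by apply/diff_locallyP; rewrite dfx.
Unshelve. all: by end_near. Qed.

Lemma differentiable_epsE (V W : normedModType R) (f : V -> W) (x : V) :
  differentiable f x -> forall e : R, 0 < e ->
  \forall h \near (0 : V), `|f (h + x) - f x - 'd f x h| <= e * `|h|.
Proof.
move=> /diff_locally /eqaddoP fx e e0; near=> h.
have : `|(f \o shift x - (cst (f x) + 'd f x)) h| <= e * `|h|.
  by near: h; exact: fx.
by rewrite /= opprD addrA.
Unshelve. all: by end_near. Qed.

Lemma col_sum_delta n (h : 'cV[R]_n) : h = \sum_j h j 0 *: delta_mx j 0.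
Proof.
rewrite [LHS]matrix_sum_delta; apply: eq_bigr => i _.
by rewrite big_ord_recl big_ord0 addr0.
Qed.

Lemma linear_col_sum (W : lmodType R) n (f : {linear 'cV[R]_n -> W}) h :
  f h = \sum_j h j 0 *: f (delta_mx j 0).
Proof.
rewrite [in LHS](col_sum_delta h) linear_sum; apply: eq_bigr => j _.
by rewrite linearZ.
Qed.

Lemma mulmx_Jac n m (f : 'cV[R]_n -> 'cV[R]_m) x h :
  'd f x h = Jac f x *m h.
Proof.
rewrite (linear_col_sum ('d f x)); apply/colP => i.
by rewrite summxE !mxE; apply: eq_bigr => j _; rewrite !mxE mulrC.
Qed.

Lemma mulmx_inj p q (M N : 'M[R]_(p, q)) :
  (forall v : 'cV[R]_q, M *m v = N *m v) -> M = N.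
Proof.
move=> MN; apply/matrixP => i j.
by have /colP/(_ i) := MN (delta_mx j 0); rewrite -!colE !mxE.
Qed.

Lemma Jac_eps n m (f : 'cV[R]_n -> 'cV[R]_m) (x : 'cV[R]_n) (D : 'M[R]_(m, n)) :
  (forall e : R, 0 < e ->
     \forall h \near (0 : 'cV[R]_n),
       `|f (h + x) - f x - D *m h| <= e * `|h|) ->
  differentiable f x /\ Jac f x = D.
Proof.
move=> fe.
have [df dfE] := differentiable_eps (@mulmx_continuous R _ _ 1 D) fe.
split=> //; apply: mulmx_inj => v; rewrite -mulmx_Jac.
exact: (congr1 (@^~ v) dfE).
Qed.

Lemma near_shift0 (V : normedModType R) (x : V) (P : V -> Prop) :
  (\forall q \near x, P q) -> \forall h \near (0 : V), P (h + x).
Proof. by rewrite {1}[\forall q \near _, _](near_shift 0) subr0. Qed.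

Lemma Jac_near_affine n m (f : 'cV[R]_n -> 'cV[R]_m) (x : 'cV[R]_n)
    (A : 'M[R]_(m, n)) (b : 'cV[R]_m) :
  (\forall q \near x, f q = A *m q + b) -> differentiable f x /\ Jac f x = A.
Proof.
move=> fx; apply: Jac_eps => e e0.
have fxx := nbhs_singleton fx.
have := near_shift0 fx; apply: filterS => h ->.
by rewrite fxx mulmxDr -[A *m h + _ + b]addrA addrK subrr normr0 mulr_ge0// ltW.
Qed.

End frechet.

Section star_shaped.
Context {R : realType}.
Variables (n m : nat).
Implicit Types (K : set 'cV[R]_n) (x p : 'cV[R]_n).

(** This is convexity, written as a displacement from [x] so that it fits the increments in a
    derivative at [x]. *)
Definition segment_closed K :=
  forall x q (t : R), K x -> K q -> 0 <= t <= 1 -> K (x + t *: (q - x)).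

(** The homothety [g] of centre [x] and ratio [t^-1] sends the point to [p]. By continuity it sends
    nearby points into [K], and convexity brings them back. *)
Lemma segment_interior K x p (t : R) : segment_closed K -> K x ->
  interior K p -> 0 < t <= 1 -> interior K (x + t *: (p - x)).
Proof.
move=> Kc Kx Kp /andP[t0 t1].
pose z := x + t *: (p - x).
pose g q := x + t^-1 *: (q - x).
have gz : g z = p.
  by rewrite /g /z [x + _ - _]addrC addKr scalerA mulVf ?gt_eqF// scale1r addrC subrK.
have cg : {for z, continuous g}.
  apply: (@cvgD _ _ _ (nbhs z)); first exact: cvg_cst.
  by apply: cvgZl_tmp; apply: (@cvgB _ _ _ (nbhs z)); [exact: cvg_id|exact: cvg_cst].
have : \forall q \near z, K (g q) by apply: cg; rewrite gz.
apply: filterS => q Kgq.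
have -> : q = x + t *: (g q - x).
  by rewrite /g [x + _ - _]addrC addKr scalerA divff ?gt_eqF// scale1r addrC subrK.
by apply: Kc => //; rewrite ltW.
Qed.

(* The directions [q - x] with [q] in [K] span, since [K] has interior points; so
   the derivative is determined even when [x] lies on the boundary of [K]. *)
Lemma Jac_affine_on K x (f : 'cV[R]_n -> 'cV[R]_m) (A : 'M[R]_(m, n))
    (b : 'cV[R]_m) :
  segment_closed K -> K x -> interior K !=set0 ->
  (\forall q \near x, K q -> f q = A *m q + b) ->
  differentiable f x -> Jac f x = A.
Proof.
move=> Kc Kx [p Kp] fx dfx.
(* On the segment from [x] to [q] the function is affine, so the two linear maps differ at [t *: v]
   by at most a small multiple of [t]; dividing by [t] leaves a bound by an arbitrary [e]. Limits
   are taken from the right to stay in [K]. *)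
have dir q : K q -> Jac f x *m (q - x) = A *m (q - x).
  move=> Kq; set v := q - x; apply/subr0_eq/eqP; rewrite -normr_eq0.
  apply/eqP/le_anti; rewrite normr_ge0 andbT.
  apply/ler_addgt0Pl => e e0; rewrite addr0.
  have v1_gt0 : 0 < `|v| + 1 by rewrite ltr_wpDl.
  have tv0 : (t *: v) @[t --> (0 : R)^'+] --> (0 : 'cV[R]_n).
    rewrite -[X in _ --> X](scale0r v); apply: cvgZr_tmp.
    by apply: cvg_at_right_filter; exact: cvg_id.
  have ev0 : 0 < e / (`|v| + 1) by rewrite divr_gt0.
  have /tv0 near1 := differentiable_epsE dfx ev0.
  have /tv0 near2 := near_shift0 fx.
  near (0 : R)^'+ => t.
  have t0 : 0 < t by near: t; exact: nbhs_right_gt.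
  have t1 : t <= 1 by near: t; exact: nbhs_right_le.
  have Ktv : K (t *: v + x) by rewrite addrC; apply: Kc => //; rewrite t1 ltW.
  have ftv : f (t *: v + x) = A *m (t *: v + x) + b.
    by move: Ktv; near: t; exact: near2.
  have : `|f (t *: v + x) - f x - 'd f x (t *: v)| <= e / (`|v| + 1) * `|t *: v|.
    by near: t; exact: near1.
  rewrite ftv (nbhs_singleton fx Kx) mulmx_Jac mulmxDr.
  rewrite -[A *m (t *: v) + _ + b]addrA addrK -!scalemxAr -scalerBr !normrZ.
  rewrite mulrCA ler_pM2l ?normr_gt0 ?gt_eqF// distrC => /le_trans; apply.
  by rewrite -mulrA ler_piMr ?(ltW e0)// mulrC ler_pdivrMr// mul1r lerDl.
(* Subtracting the equality at [p] from the one at [p + e *: w], which is in [K] for small [e],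
   gives agreement in an arbitrary direction [w]. *)
apply/subr0_eq/mulmx_inj => w; rewrite mulmxBl mul0mx.
have cw : (p + e *: w) @[e --> (0 : R)^'+] --> p.
  rewrite -[X in _ --> X]addr0; apply: cvgD; first exact: cvg_cst.
  rewrite -[X in _ --> X](scale0r w); apply: cvgZr_tmp.
  by apply: cvg_at_right_filter; exact: cvg_id.
near (0 : R)^'+ => e.
have e0 : 0 < e by near: e; exact: nbhs_right_gt.
have Kpw : K (p + e *: w) by near: e; exact: cw.
have := dir _ Kpw; rewrite addrAC mulmxDr [A *m (_ + _)]mulmxDr.
rewrite (dir p (interior_subset Kp)) => /addrI.
rewrite -!scalemxAr => /(scalerI (lt0r_neq0 e0)) ->.
by rewrite subrr.
Unshelve. all: by end_near. Qed.

End star_shaped.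

(** * Clarke Jacobians of piecewise affine maps *)

Section polyhedra.
Context {R : realType}.
Variable n : nat.
Implicit Type P : set 'cV[R]_n.

Lemma polyhedron_closed P : polyhedron P -> closed P.
Proof.
move=> [p [C [c ->]]].
rewrite (_ : [set u | _] =
    \bigcap_(k in [set: 'I_p]) ((fun u => (C *m u) k 0) @^-1` [set t | t <= c k 0])).
  apply: closed_bigI => k _.
  apply: (iffLR (continuous_closedP _)); last exact: closed_le.
  move=> u; apply: (@cvg_comp _ _ _ (mulmx C) (fun v : 'cV[R]_p => v k 0)).
    exact: mulmx_continuous.
  exact: coord_continuous.
by apply/seteqP; split=> u /= H k; [move=> _; exact: H|exact: (H k I)].
Qed.

Lemma polyhedron_segment_closed P : polyhedron P -> segment_closed P.
Proof.
move=> [p [C [c ->]]] x q t /= Cx Cq /andP[t0 t1] k.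
rewrite mulmxDr -scalemxAr mulmxBr.
rewrite (_ : _ k 0 = (1 - t) * (C *m x) k 0 + t * (C *m q) k 0); last first.
  by rewrite !mxE; ring.
rewrite (_ : c k 0 = (1 - t) * c k 0 + t * c k 0); last by ring.
by rewrite lerD// ler_wpM2l// subr_ge0.
Qed.

End polyhedra.

Section piecewise_affine.
Context {R : realType}.
Variables (n m k : nat) (U : set 'cV[R]_n) (y : 'cV[R]_n -> 'cV[R]_m).
Variables (cell : 'I_k -> set 'cV[R]_n) (A : 'I_k -> 'M[R]_(m, n)).
Variable b : 'I_k -> 'cV[R]_m.
Hypothesis U_open : open U.
Hypothesis y_pwa : continuous_piecewise_affine U y cell A b.

Lemma cell_polyhedron i : polyhedron (cell i).
Proof. by case: y_pwa => -[]. Qed.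

Lemma cell_cover u : U u -> exists i, cell i u.
Proof. by case: y_pwa => -[_ _ _ UC] _ _ /UC[i _ iu]; exists i. Qed.

Lemma active_cell u i : active cell u i <-> cell i u.
Proof.
have /closure_id cl := polyhedron_closed (cell_polyhedron i).
by rewrite /active /= -cl.
Qed.

Lemma near_cell_affine x i : U x -> \forall q \near x, cell i q ->
  y q = A i *m q + b i.
Proof.
case: y_pwa => _ _ yE Ux.
have : \forall q \near x, U q by apply: open_nbhs_nbhs.
by apply: filterS => q Uq; exact: yE.
Qed.

Lemma interior_cell_Jac x i : U x -> interior (cell i) x ->
  differentiable y x /\ Jac y x = A i.
Proof.
move=> Ux ix; apply: (@Jac_near_affine _ _ _ _ _ _ (b i)).
exact: filterS2 (near_cell_affine i Ux) ix => q; apply.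
Qed.

(** The point may lie on the boundary of several cells: differentiability there forces their
    matrices to coincide. *)
Lemma cell_Jac x i : U x -> cell i x -> differentiable y x -> Jac y x = A i.
Proof.
move=> Ux ix; apply: (@Jac_affine_on _ _ _ (cell i) _ _ _ (b i)) => //.
- exact: polyhedron_segment_closed (cell_polyhedron i).
- by case: y_pwa => -[].
- exact: near_cell_affine.
Qed.

(** There are finitely many cells and they are closed, so those that miss [x] miss a common
    neighborhood of [x]. *)
Lemma near_cell_sub x : \forall q \near x, forall i, cell i q -> cell i x.
Proof.
apply: (@filter_forall _ _ (fun i q => cell i q -> cell i x) (nbhs x) _) => i.
have [ix|ix] := pselect (cell i x); first exact: nearW.
have : \forall q \near x, ~ cell i q.
  apply: open_nbhs_nbhs; split=> //.
  by apply: closed_openC; exact: polyhedron_closed (cell_polyhedron i).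
by apply: filterS.
Qed.

Lemma interior_cell_seq x i : U x -> cell i x ->
  exists u : nat -> 'cV[R]_n,
    (forall j, U (u j) /\ interior (cell i) (u j)) /\ u @ \oo --> x.
Proof.
move=> Ux ix.
have [p ip] : interior (cell i) !=set0 by case: y_pwa => -[].
(* [harmonic j] is 1/(j+1), a ratio in ]0, 1] from [j = 0] on, as [segment_interior] requires. *)
pose v j : 'cV[R]_n := x + harmonic j *: (p - x).
have vx : v @ \oo --> x.
  rewrite -[X in _ --> X]addr0; apply: cvgD; first exact: cvg_cst.
  rewrite -[X in _ --> X](scale0r (p - x)); apply: cvgZr_tmp.
  exact: cvg_harmonic.
have [N _ NU] : \forall j \near \oo, U (v j).
  by apply: vx; exact: open_nbhs_nbhs.
(* The shift by [N] drops the first terms, which may fall outside [U]. *)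
exists (fun j => v (j + N)%N); split; last by rewrite cvg_shiftn.
move=> j; split; first by apply: NU; rewrite /= leq_addl.
apply: segment_interior => //.
  exact: polyhedron_segment_closed (cell_polyhedron i).
by rewrite /harmonic /= invr_gt0 ltr0n invf_le1// ler1n.
Qed.

(** Near [x] every Jacobian belongs to the finite, hence closed, set of active matrices, and so does
    any limit. Conversely, the Jacobian is constantly [A i] along interior points of an active
    cell. *)
Lemma limit_Jac_cells x : U x ->
  [set V : 'M[R]_(m, n) | exists u : nat -> 'cV[R]_n,
    [/\ forall k, differentiable y (u k), u @ \oo --> x
      & (fun k => Jac y (u k)) @ \oo --> V]] =
  [set A i | i in active cell x].
Proof.
move=> Ux; apply/seteqP; split=> [V [u [du ux JV]]|_ [i /active_cell ix <-]].
  have clS : closed [set A i | i in active cell x].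
    apply: (iffLR (@accessible_finite_set_closed 'M[R]_(m, n))).
      by apply: hausdorff_accessible; exact: norm_hausdorff.
    by apply: finite_image; exact: finite_finset.
  apply: (closed_cvg _ clS _ _ JV).
  have Uu : \forall j \near \oo, U (u j) by apply: ux; exact: open_nbhs_nbhs.
  have Su : \forall j \near \oo, forall i, cell i (u j) -> cell i x.
    exact: (ux _ (near_cell_sub x)).
  near=> j.
  have Uj : U (u j) by near: j.
  have [i iu] := cell_cover Uj.
  exists i; last by rewrite (cell_Jac Uj iu).
  by apply/active_cell; move: (i) iu; near: j.
have [u [Uu ux]] := interior_cell_seq Ux ix.
have Ju j := interior_cell_Jac (Uu j).1 (Uu j).2.
exists u; split=> //; first by move=> j; case: (Ju j).
rewrite (_ : (fun j => _) = cst (A i)); first exact: cvg_cst.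
by apply/funext => j; case: (Ju j).
Unshelve. all: by end_near. Qed.

Lemma clarke_Jac_cells x : U x ->
  clarke_Jac y x = conv_hull [set A i | i in active cell x].
Proof. by move=> Ux; rewrite /clarke_Jac limit_Jac_cells. Qed.

End piecewise_affine.

(** * Convex hulls and the chain rule *)

Section hulls.
Context {R : realType}.

(** [conv_hull] requires every listed point to be in [S], even with weight 0. Such points are
    replaced by some [a j0] of positive weight, which exists because the weights sum to 1. *)
Lemma conv_hull_sum (E : lmodType R) (S : set E) k (w : 'I_k -> R)
    (a : 'I_k -> E) :
  (forall j, 0 <= w j) -> \sum_j w j = 1 -> (forall j, 0 < w j -> S (a j)) ->
  conv_hull S (\sum_j w j *: a j).
Proof.
move=> w0 w1 Sa.
have [j0 wj0] : exists j, 0 < w j.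
  apply: contrapT => /forallNP nw; have : \sum_j w j <= 0.
    by apply: sumr_le0 => j _; rewrite leNgt; apply/negP/nw.
  by rewrite w1 ler10.
exists k, w, (fun j => if 0 < w j then a j else a j0); split => //.
  by move=> j; case: ifPn => [/Sa|_]//; exact: Sa.
apply: eq_bigr => j _; case: ifPn => // wj.
have -> : w j = 0 by apply: le_anti; rewrite w0 leNgt wj.
by rewrite !scale0r.
Qed.

Lemma sub_conv_hull (E : lmodType R) (S : set E) : S `<=` conv_hull S.
Proof.
move=> a Sa; exists 1%N, (fun=> 1), (fun=> a); split => //.
- by rewrite big_ord1.
- by rewrite big_ord1 scale1r.
Qed.

(** Affine maps commute with convex combinations; the constant [c] factors out because the weights
    sum to 1. *)
Lemma conv_hull_affine (E E' : lmodType R) (S : set E) (S' : set E')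
    (f : E -> E') (c : E') : linear f ->
  (forall a, S a -> S' (c + f a)) ->
  forall v, conv_hull S v -> conv_hull S' (c + f v).
Proof.
move=> lf SS' v [k [w [a [w0 w1 Sa ->]]]].
pose fL : {linear E -> E'} := HB.pack f (GRing.isLinear.Build _ _ _ _ f lf).
exists k, w, (fun j => c + f (a j)); split => //; first by move=> j; exact: SS'.
under [RHS]eq_bigr do rewrite scalerDr.
rewrite big_split/= -scaler_suml w1 scale1r -[f (\sum_j _)]/(fL _).
rewrite linear_sum; congr +%R.
by apply: eq_bigr => j _; rewrite linearZ.
Qed.

Lemma trmx_mulmx_linear m n (v : 'cV[R]_m) :
  linear (fun M : 'M[R]_(m, n) => M^T *m v).
Proof. by move=> a M N; rewrite linearP mulmxDl -scalemxAl. Qed.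

Lemma conv_hull_mono (E : lmodType R) (S S' : set E) :
  S `<=` S' -> conv_hull S `<=` conv_hull S'.
Proof.
move=> SS' v [k [w [a [w0 w1 Sa ->]]]].
by exists k, w, a; split => // j; exact: SS'.
Qed.

Lemma conv_hull1 (E : lmodType R) (S : set E) (a v : E) :
  (forall s, S s -> s = a) -> conv_hull S v -> v = a.
Proof.
move=> Sa [k [w [s [_ w1 Ss ->]]]].
under eq_bigr do rewrite (Sa _ (Ss _)).
by rewrite -scaler_suml w1 scale1r.
Qed.

Lemma dist_eq0 (E : zmodType) (nrm : E -> R) (z : E) (S : set E) :
  (forall e, 0 <= nrm e) -> nrm 0 = 0 -> S z -> dist nrm z S = 0%E.
Proof.
move=> nrm_ge0 nrm0 Sz; apply/le_anti/andP; split.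
  by apply: ereal_inf_lbound; exists z; rewrite ?subrr ?nrm0.
by apply: le_ereal_inf_tmp => _ [s _ <-]; rewrite lee_fin.
Qed.

(** Nonemptiness matters: the supremum of the empty set is [-oo]. *)
Lemma ereal_sup_image_cst (T : Type) (S : set T) (f : T -> \bar R) (c : \bar R) :
  S !=set0 -> (forall t, S t -> f t = c) -> ereal_sup [set f t | t in S] = c.
Proof.
move=> [t St] fc; rewrite (_ : [set _ | _ in _] = [set c]) ?ereal_sup1//.
by apply/seteqP; split=> [_ [s Ss <-]|_ ->]/=; [exact: fc|exists t; rewrite ?fc].
Qed.

Lemma opnorm_ge0 m n (M : 'M[R]_(m, n)) : 0 <= opnorm M.
Proof.
rewrite /opnorm; set S := [set _ | _ in _].
(* By convention [sup] is 0 on a set without a supremum, so both cases give a nonnegative value. *)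
have [Ssup|nSsup] := pselect (has_sup S); last by rewrite sup_out.
apply: ub_le_sup; first exact: (proj2 Ssup).
by exists 0; rewrite /= ?mulmx0 enorm0 ?ler01.
Qed.

Lemma opnorm0 m n : opnorm (0 : 'M[R]_(m, n)) = 0.
Proof.
rewrite /opnorm (_ : [set _ | _ in _] = [set 0]) ?sup1//.
apply/seteqP; split=> [_ [v _ <-]|_ ->]/=; first by rewrite mul0mx enorm0.
by exists 0; rewrite /= ?mulmx0 enorm0 ?ler01.
Qed.

End hulls.

Lemma cvg_col (R : realType) (T : Type) (F : set_system T) {FF : Filter F} n
    (f : T -> 'I_n -> R) (l : 'I_n -> R) :
  (forall j, f t j @[t --> F] --> l j) ->
  (\col_j f t j) @[t --> F] --> \col_j l j.
Proof.
move=> fl; apply: cvg_mx => i j; rewrite mxE.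
by under eq_fun do rewrite mxE; exact: fl.
Qed.

Section chain_rule.
Context {R : realType}.
Variables (n m : nat) (phi : 'cV[R]_n -> 'cV[R]_m -> R).
Variable y : 'cV[R]_n -> 'cV[R]_m.
Let F (p : 'cV[R]_n * 'cV[R]_m) := phi p.1 p.2.
Hypothesis phi_C1 : C1 F.

(** Partial differentials are the total one restricted to a factor; the continuity in [C1] thereby
    reaches [grad1] and, with the next lemma, [grad2]. *)
Lemma diff_curry1 u w v : 'd (fun u' => phi u' w) u v = 'd F (u, w) (v, 0).
Proof.
have Fd : differentiable F (u, w) by case: phi_C1.
rewrite (_ : (fun _ => _) = F \o (fun u' => (u', w))) //.
have pd : differentiable (fun u' : 'cV[R]_n => (u', w)) u.
  by apply: differentiable_pair.
rewrite diff_comp//= diff_pair//= diff_cst.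
by rewrite [X in 'd F _ X](_ : _ = (v, 0)) //; congr pair; rewrite diff_val.
Qed.

Lemma diff_curry2 u w v : 'd (phi u) w v = 'd F (u, w) (0, v).
Proof.
have Fd : differentiable F (u, w) by case: phi_C1.
rewrite (_ : phi u = F \o (fun w' => (u, w'))) //.
have pd : differentiable (fun w' : 'cV[R]_m => (u, w')) w.
  by apply: differentiable_pair.
rewrite diff_comp//= diff_pair//= diff_cst.
by rewrite [X in 'd F _ X](_ : _ = (0, v)) //; congr pair; rewrite diff_val.
Qed.

Lemma diff_phi_tilde u : differentiable y u ->
  differentiable (phi_tilde phi y) u /\
  grad (phi_tilde phi y) u = d_x phi y u + (Jac y u)^T *m d_y phi y u.
Proof.
move=> yu.
have Fd : differentiable F (u, y u) by case: phi_C1.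
have pd : differentiable (fun v => (v, y v)) u by apply: differentiable_pair.
have -> : phi_tilde phi y = F \o (fun v => (v, y v)) by [].
split; first exact: differentiable_comp.
apply/colP => j; rewrite !mxE diff_comp//= diff_pair//=.
rewrite (diff_val : 'd id u = id :> (_ -> _))/=.
set e := delta_mx j 0.
(* Splitting the increment separates the two partial differentials; expanding the second over the
   canonical basis produces the transposed Jacobian. *)
have -> : (e, 'd y u e) = (e, 0) + (0, 'd y u e).
  by congr pair; rewrite ?addr0 ?add0r.
rewrite linearD -diff_curry1 -diff_curry2; congr +%R.
rewrite (linear_col_sum ('d (phi u) (y u))); apply: eq_bigr => i _.
by rewrite !mxE.
Qed.

(** Each entry is the differential of [F] on a fixed vector, and [C1] makes it continuous in the
    base point [(u, y u)]. *)
Lemma continuous_d_x x : {for x, continuous y} ->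
  {for x, continuous (d_x phi y)}.
Proof.
move=> yx.
have -> : d_x phi y = (fun u => \col_j 'd F (u, y u) (delta_mx j 0, 0)).
  by apply/funext => u; apply/colP => j; rewrite !mxE; exact: diff_curry1.
apply: (@cvg_col _ _ (nbhs x)) => j.
apply: (@cvg_comp _ _ _ (fun u => (u, y u)) (fun p => 'd F p (delta_mx j 0, 0))
  _ (nbhs (x, y x))).
  by apply: (@cvg_pair _ _ _ (nbhs x) (nbhs x) (nbhs (y x))).
exact: (proj2 phi_C1 (delta_mx j 0, 0) (x, y x)).
Qed.

Lemma continuous_d_y x : {for x, continuous y} ->
  {for x, continuous (d_y phi y)}.
Proof.
move=> yx.
have -> : d_y phi y = (fun u => \col_j 'd F (u, y u) (0, delta_mx j 0)).
  by apply/funext => u; apply/colP => j; rewrite !mxE; exact: diff_curry2.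
apply: (@cvg_col _ _ (nbhs x)) => j.
apply: (@cvg_comp _ _ _ (fun u => (u, y u)) (fun p => 'd F p (0, delta_mx j 0))
  _ (nbhs (x, y x))).
  by apply: (@cvg_pair _ _ _ (nbhs x) (nbhs x) (nbhs (y x))).
exact: (proj2 phi_C1 (0, delta_mx j 0) (x, y x)).
Qed.

End chain_rule.

Section clarke_cells.
Context {R : realType}.
Variables (n m k : nat) (U : set 'cV[R]_n) (y : 'cV[R]_n -> 'cV[R]_m).
Variables (cell : 'I_k -> set 'cV[R]_n) (A : 'I_k -> 'M[R]_(m, n)).
Variable b : 'I_k -> 'cV[R]_m.
Hypothesis U_open : open U.
Hypothesis y_pwa : continuous_piecewise_affine U y cell A b.

(** Regularity makes every cell active at a point [s] of the ball active at [x], so the Clarke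
    Jacobian at [s] is contained in that at [x] and all distances vanish. *)
Lemma clarke_variation_eq0 x delta : 0 <= delta -> eball x delta `<=` U ->
  ball_active cell x delta `<=` active cell x -> clarke_variation y x delta = 0%E.
Proof.
move=> d0 xU reg.
have xx : eball x delta x by rewrite /eball /= subrr enorm0.
have sub s : eball x delta s -> clarke_Jac y s `<=` clarke_Jac y x.
  move=> xs; rewrite (clarke_Jac_cells U_open y_pwa (xU _ xs)).
  rewrite (clarke_Jac_cells U_open y_pwa (xU _ xx)).
  apply: conv_hull_mono => _ [i /(active_cell y_pwa) si <-].
  by exists i => //; apply: reg; exists s.
have nonempty s : eball x delta s -> clarke_Jac y s !=set0.
  move=> xs; have [i si] := cell_cover y_pwa (xU _ xs).
  exists (A i); rewrite (clarke_Jac_cells U_open y_pwa (xU _ xs)).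
  by apply: sub_conv_hull; exists i => //; exact/(active_cell y_pwa).
apply: ereal_sup_image_cst => [|s xs]; first by exists x.
apply: ereal_sup_image_cst => [|V sV]; first exact: nonempty.
by apply: dist_eq0; [exact: opnorm_ge0|exact: opnorm0|exact: sub sV].
Qed.

Variable phi : 'cV[R]_n -> 'cV[R]_m -> R.
Hypothesis phi_C1 : C1 (fun p : 'cV[R]_n * 'cV[R]_m => phi p.1 p.2).

(** Along interior points of cell [i] the gradient is [d_x + (A i)^T d_y] at those points, and it
    converges by continuity of [d_x] and [d_y]. The affine map [M |-> d_x + M^T d_y] then carries
    the hull over. *)
Lemma clarke_subdiff_cells x M : U x ->
  conv_hull [set A i | i in active cell x] M ->
  clarke_subdiff (phi_tilde phi y) x (d_x phi y x + M^T *m d_y phi y x).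
Proof.
move=> Ux; have yx : {for x, continuous y} by case: y_pwa => _ + _; apply.
apply: (conv_hull_affine (trmx_mulmx_linear _)) => _ [i /(active_cell y_pwa) ix <-].
have [u [Uu ux]] := interior_cell_seq U_open y_pwa Ux ix.
have Ju j := interior_cell_Jac U_open y_pwa (Uu j).1 (Uu j).2.
have gu j := diff_phi_tilde phi_C1 (Ju j).1.
exists u; split => // [j|]; first by case: (gu j).
under eq_fun do rewrite (gu _).2 (Ju _).2.
apply: cvgD.
  exact: cvg_comp ux (continuous_d_x phi_C1 yx).
apply: (@cvg_comp _ _ _ (d_y phi y \o u) (mulmx (A i)^T)).
  exact: cvg_comp ux (continuous_d_y phi_C1 yx).
exact: mulmx_continuous.
Qed.

End clarke_cells.

(** * Lebesgue measure of hyperplanes and balls *)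

Section lebesgue_tuple.
Context {R : realType}.
Local Notation mR := (measurableTypeR R).

Lemma measurable_le_cst d (T : measurableType d) (f : T -> R) (c : R) :
  measurable_fun setT f -> measurable [set t | f t <= c].
Proof.
move=> mf; have -> : [set t | f t <= c] = setT `&` f @^-1` `]-oo, c].
  by rewrite setTI; apply/seteqP; split=> t /=; rewrite in_itv.
exact: mf.
Qed.

Lemma measurable_affine n (a : 'I_n -> R) (c : R) :
  measurable_fun [set: n.-tuple mR] (fun t => \sum_j a j * tnth t j + c).
Proof.
apply: measurable_funD; last exact: measurable_cst.
apply: measurable_sum => j; apply: measurable_funM; first exact: measurable_cst.
exact: measurable_tnth.
Qed.

Lemma measurable_hyperplane n (a : 'I_n -> R) (c : R) :
  measurable [set t : n.-tuple mR | \sum_j a j * tnth t j + c = 0].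
Proof.
rewrite (_ : [set t | _] = setT `&`
    (fun t : n.-tuple mR => \sum_j a j * tnth t j + c) @^-1` [set 0]).
  exact: measurable_affine.
by rewrite setTI.
Qed.

(** Induction by slicing along the first coordinate. If a later coefficient is nonzero, each slice
    is a null hyperplane; otherwise the set is one value of the first coordinate times the whole
    space. *)
Lemma lebesgue_tuple_hyperplane n (a : 'I_n -> R) (c : R) :
  (exists j, a j != 0) ->
  lebesgue_tuple n [set t : n.-tuple mR | \sum_j a j * tnth t j + c = 0] = 0%E.
Proof.
elim: n a c => [a c [[]]//|n IH a c a_neq0].
rewrite /= /lebesgue_step /pushforward.
set H := _ @^-1` _.
have HE : H = [set p | \sum_j a (lift ord0 j) * tnth p.2 j + (a ord0 * p.1 + c) = 0].
  have sumE p : \sum_j a j * tnth (tcons p) j + c =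
      \sum_j a (lift ord0 j) * tnth p.2 j + (a ord0 * p.1 + c).
    rewrite big_ord_recl /tcons tnth0 addrAC addrC; congr (_ + _).
    by apply: eq_bigr => j _; rewrite tnthS.
  by apply/seteqP; split=> p; rewrite /H /= sumE.
have [[j aj]|a0] := pselect (exists j, a (lift ord0 j) != 0).
  rewrite /product_measure1 integral0_eq// => s _ /=.
  rewrite -(IH (fun j => a (lift ord0 j)) (a ord0 * s + c)); last by exists j.
  congr (lebesgue_tuple n _); apply/seteqP; split=> t; rewrite HE.
    by rewrite /xsection /= inE.
  by rewrite /xsection /= inE.
have {}a0 j : a (lift ord0 j) = 0.
  by apply/eqP/negPn/negP => aj; apply: a0; exists j.
have a00 : a ord0 != 0.
  by case: a_neq0 => j; case: (unliftP ord0 j) => [i|] ->//; rewrite a0 eqxx.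
have -> : H = [set - c / a ord0] `*` setT.
  rewrite HE; apply/seteqP; split=> -[s t] /=;
    rewrite big1 ?add0r => [|j _]; rewrite ?a0 ?mul0r//.
    move=> /eqP; rewrite addr_eq0 => /eqP asc; split => //.
    by rewrite -asc mulrAC divff// mul1r.
  by move=> [-> _]; rewrite mulrC divfK// addNr.
have m1 : measurable ([set - c / a ord0] : set mR) by exact: measurable_set1.
(* The whole-space factor may have infinite measure; the product is still 0 because [0 * +oo] is
   0. *)
rewrite product_measure1E//.
by rewrite [X in (X * _)%E](lebesgue_measure_set1 (- c / a ord0)) mul0e.
Qed.

(** This is the domain of integration in [unif_ball_mean]. *)
Definition ball_tuple n : set (n.-tuple mR) :=
  [set t | eball 0 1 (col_of_tuple t)].

Lemma measurable_ball_tuple n : measurable (@ball_tuple n).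
Proof.
apply: measurable_le_cst; apply: measurableT_comp => //.
  by apply: continuous_measurable_fun; exact: sqrt_continuous.
apply: measurable_sum => j.
rewrite (_ : (fun t => _) = fun t : n.-tuple mR => tnth t j ^+ 2); last first.
  by apply/funext => t; rewrite subr0 mxE.
by apply: measurable_funX; exact: measurable_tnth.
Qed.

(** Cubes are boxes of explicit measure; enclosing the unit ball between two of them shows that its
    measure is positive and finite. *)
Definition cube_tuple n (r : R) : set (n.-tuple mR) :=
  [set t | forall i, `[- r, r]%classic (tnth t i)].

Lemma measurable_cube_tuple n r : measurable (@cube_tuple n r).
Proof.
rewrite (_ : @cube_tuple n r =
    \bigcap_i (fun t : n.-tuple mR => tnth t i) @^-1` `[- r, r]).
  apply: fin_bigcap_measurable => // i _.
  by rewrite -[X in measurable X]setTI; exact: (measurable_tnth i).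
by apply/seteqP; split=> t /= Ht i; [move=> _; exact: Ht|exact: (Ht i I)].
Qed.

Lemma lebesgue_tuple_cube n (r : R) : 0 < r ->
  (0 < lebesgue_tuple n (@cube_tuple n r) < +oo)%E.
Proof.
move=> r0; rewrite (lebesgue_tuple_box (A := fun=> `[- r, r]%classic))//.
apply: (big_ind (fun p : \bar R => (0 < p < +oo)%E)) => [|p q|i _].
- by rewrite lte01 ltry.
- move=> /andP[p0 poo] /andP[q0 qoo].
  by rewrite mule_gt0//= lte_mul_pinfty// ?ltW// ge0_fin_numE// ltW.
- rewrite lebesgue_measure_itv/= lte_fin gtrN// -EFinD lte_fin ltry andbT.
  by rewrite opprK addr_gt0.
Qed.

Lemma ball_tuple_finite n : (lebesgue_tuple n (@ball_tuple n) < +oo)%E.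
Proof.
have /andP[_] := lebesgue_tuple_cube n (@ltr01 R); apply: le_lt_trans.
apply: le_measure; rewrite ?inE; first exact: measurable_ball_tuple.
  exact: measurable_cube_tuple.
move=> t; rewrite /ball_tuple /eball /= subr0 => t1 i; rewrite /= in_itv/= -ler_norml.
have := mx_entry_le (col_of_tuple t) i 0; rewrite mxE => /le_trans; apply.
exact: le_trans (norm_le_enorm _) t1.
Qed.

Lemma ball_tuple_gt0 n : (0 < lebesgue_tuple n (@ball_tuple n))%E.
Proof.
(* By [enorm_le_norm] a half-side of at most 1/n suffices; [n.+1] keeps it positive in dimension 0,
   where the inverse of 0 is 0. *)
have r0 : 0 < n.+1%:R^-1 :> R by rewrite invr_gt0.
have /andP[+ _] := lebesgue_tuple_cube n r0; move=> /lt_le_trans; apply.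
apply: le_measure; rewrite ?inE; last 2 first.
- exact: measurable_ball_tuple.
- move=> t tr; rewrite /ball_tuple /eball /= subr0.
  rewrite (le_trans (enorm_le_norm _))//.
  have : `|col_of_tuple t| <= n.+1%:R^-1.
    apply: mx_norm_le; first exact: ltW.
    by move=> i j; rewrite mxE; have := tr i; rewrite /= in_itv/= -ler_norml.
  move=> /(ler_wpM2l (ler0n R n)) /le_trans; apply.
  by rewrite ler_pdivrMr// mul1r ler_nat.
exact: measurable_cube_tuple.
Qed.

End lebesgue_tuple.

(** * Integrals of small remainders and of step functions *)

Section integral_lemmas.
Context d (T : measurableType d) {R : realType}.
Variables (mu : {measure set T -> \bar R}) (B : set T).
Hypothesis mB : measurable B.
Hypothesis B_fin : (mu B < +oo)%E.

Lemma Rintegral_littleo (V : normedModType R) (G : V -> T -> R) (C : R) :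
  (\forall h \near (0 : V), measurable_fun B (G h)) ->
  (\forall h \near (0 : V), forall t, B t -> `|G h t| <= C * `|h|) ->
  {ae mu, forall t, B t -> \forall h \near (0 : V), G h t = 0} ->
  forall e : R, 0 < e ->
  \forall h \near (0 : V), `|\int[mu]_(t in B) G h t| <= e * `|h|.
Proof.
(* Dominated convergence is available for sequences only: along offending
   [h n --> 0], the quotients [G (h n) t / `|h n|] are bounded by [C] and
   eventually vanish for almost every [t]. *)
move=> mG bG G0 e e0; apply: contrapT => not_littleo.
have /choice[h hP] : forall n : nat, exists h : V, [/\ `|h| < harmonic n,
    measurable_fun B (G h), (forall t, B t -> `|G h t| <= C * `|h|)
  & e * `|h| < `|\int[mu]_(t in B) G h t|].
  move=> n; apply: contrapT => /forallNP nh; apply: not_littleo.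
  near=> h; rewrite leNgt; apply/negP => eh; apply: (nh h); split => //.
  - near: h; apply: nbhs0_lt; exact: harmonic_gt0.
  - by near: h.
  - by near: h.
(* At [h n = 0] the bound would make the integrand vanish, against the strict inequality in the
   choice of [h n]. *)
have h_gt0 n : 0 < `|h n|.
  have [_ _ bh] := hP n; rewrite normr_gt0; apply: contraTneq => hn0.
  rewrite hn0 normr0 mulr0 -leNgt normr_le0 (@eq_Rintegral _ _ _ _ _ (cst 0)).
    by rewrite /= Rintegral_cst// mul0r.
  move=> t; rewrite inE => Bt; apply/eqP; rewrite -normr_le0.
  by have := bh t Bt; rewrite hn0 normr0 mulr0.
have h_cvg0 : h @ \oo --> (0 : V).
  apply/cvgr0Pnorm_lt => r r0.
  near=> n; have [hn _ _ _] := hP n; apply: lt_trans hn _.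
  by near: n; exact: (cvgr_lt _ cvg_harmonic).
pose f n t := (`|h n|^-1 * G (h n) t)%:E.
have [|||||_ _] := @dominated_convergence _ T R mu B mB f (cst 0%E) (cst C%:E).
- move=> n; have [_ mGn _ _] := hP n; apply/measurable_EFinP.
  by apply: measurable_funM => //; exact: measurable_cst.
- exact: measurable_cst.
- apply: filterS G0 => t G0t Bt; apply: cvg_near_cst.
  have hG : \forall n \near \oo, G (h n) t = 0 := h_cvg0 _ (G0t Bt).
  apply: filterS hG => n Gn.
  by rewrite /f Gn mulr0.
- apply: (@measurable_bounded_integrable _ _ _ _ (cst C)) => //.
  exact: bounded_cst.
- apply: aeW => t n Bt; have [_ _ bh _] := hP n.
  rewrite lee_fin normrM ger0_norm ?invr_ge0// mulrC ler_pdivrMr//.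
  exact: bh.
rewrite integral_cst// mul0e => /fine_cvgP[_ /cvgr0Pnorm_lt/(_ e e0)].
(* One index at which the integral of the quotient is below [e] contradicts the choice of [h n]. *)
move=> /(@filter_ex _ _ _)[n] small.
have [_ mGn bh] := hP n.
have : `|\int[mu]_(t in B) (`|h n|^-1 * G (h n) t)| < e by exact: small.
rewrite RintegralZl//.
  rewrite normrM ger0_norm ?invr_ge0// mulrC ltr_pdivrMr// => lt1 lt2.
  by have := lt_trans lt1 lt2; rewrite ltxx.
apply: measurable_bounded_integrable => //.
exists (C * `|h n|); split; first exact: num_real.
by move=> M CM t /bh /le_trans; apply; exact: ltW.
Unshelve. all: by end_near. Qed.

Lemma integrable_indicM (P : set T) (c : R) : measurable P ->
  mu.-integrable B (EFin \o (fun t => c * \1_P t)).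
Proof.
move=> mP; apply: measurable_bounded_integrable => //.
  apply: measurable_funM; first exact: measurable_cst.
  exact: measurable_indic.
exists `|c|; split; first exact: num_real.
move=> M cM t _; apply: le_trans (ltW cM).
by rewrite normrM ler_piMr// indicE; case: (_ \in _); rewrite ?normr1 ?normr0.
Qed.

Lemma integrable_sum_indic k (P : 'I_k -> set T) (c : 'I_k -> R) :
  (forall j, measurable (P j)) ->
  mu.-integrable B (EFin \o (fun t => \sum_j c j * \1_(P j) t)).
Proof.
move=> mP.
rewrite (_ : EFin \o _ = fun t => (\sum_(j < k) (c j * \1_(P j) t)%:E)%E).
  by apply: integrable_sum => // j _; exact: integrable_indicM.
by apply/funext => t; rewrite sumEFin.
Qed.

Lemma Rintegral_sum_indic k (P : 'I_k -> set T) (c : 'I_k -> R) :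
  (forall j, measurable (P j)) -> (forall j, P j `<=` B) ->
  \int[mu]_(t in B) (\sum_j c j * \1_(P j) t) = \sum_j c j * fine (mu (P j)).
Proof.
move=> mP PB; rewrite /Rintegral.
under eq_integral do rewrite -sumEFin.
rewrite integral_sum// => [|j]; last exact: integrable_indicM.
rewrite -sum_fine => [|j _]; last first.
  by apply: integrable_fin_num => //; exact: integrable_indicM.
apply: eq_bigr => j _; rewrite -/(Rintegral mu B (fun t => c j * \1_(P j) t)).
rewrite RintegralZl//.
  by rewrite /Rintegral integral_indic// (setIidl (PB j)).
have := integrable_indicM 1 (mP j).
by rewrite (_ : (fun t => 1 * _) = \1_(P j))//; apply/funext => t; rewrite mul1r.
Qed.

End integral_lemmas.

(** * Smoothing of piecewise affine maps *)

Lemma negligible_bigcup_ord d (T : sigmaRingType d) (R : realType)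
    (mu : {measure set T -> \bar R}) p (F : 'I_p -> set T) :
  (forall i, mu.-negligible (F i)) -> mu.-negligible (\bigcup_i F i).
Proof.
move=> F0; pose G r := if insub r is Some i then F i else set0.
apply: (@negligibleS _ _ _ _ (\bigcup_r G r)).
  by move=> t [i _ Fit]; exists (val i) => //; rewrite /G valK.
apply: negligible_bigcup => r; rewrite /G.
by case: insubP => [i _ _|_]; [exact: F0|exact: negligible_set0].
Qed.

Section ball_points.
Context {R : realType}.
Local Notation mR := (measurableTypeR R).
Variables (n : nat) (delta : R).
Implicit Types (u : 'cV[R]_n) (P : set 'cV[R]_n).

Definition ball_point u (t : n.-tuple mR) : 'cV[R]_n :=
  u + delta *: col_of_tuple t.

Lemma mulmx_ball_point p (C : 'M[R]_(p, n)) u t r :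
  (C *m ball_point u t) r 0 = \sum_j (delta * C r j) * tnth t j + (C *m u) r 0.
Proof.
rewrite mulmxDr -scalemxAr mxE addrC; congr (_ + _).
rewrite !mxE mulr_sumr; apply: eq_bigr => j _.
by rewrite !mxE mulrA.
Qed.

Lemma measurable_mulmx_ball_point p (C : 'M[R]_(p, n)) u r :
  measurable_fun setT (fun t => (C *m ball_point u t) r 0).
Proof.
under eq_fun do rewrite mulmx_ball_point.
exact: measurable_affine.
Qed.

Lemma measurable_polyhedron_ball_point P u :
  polyhedron P -> measurable [set t | P (ball_point u t)].
Proof.
move=> [p [C [c ->]]].
rewrite (_ : [set t | _] =
    \bigcap_(r in [set: 'I_p]) [set t | (C *m ball_point u t) r 0 <= c r 0]).
  apply: fin_bigcap_measurable => // r _.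
  by apply: measurable_le_cst; exact: measurable_mulmx_ball_point.
by apply/seteqP; split=> t /= Pt r; [move=> _; exact: Pt|exact: (Pt r I)].
Qed.

(** A point of [P] at which all constraints with a nonzero row are strict is interior, so the
    frontier lies in finitely many hyperplanes. [delta != 0] keeps their normals nonzero in the
    variable [t]. *)
Lemma polyhedron_frontier_negligible P u : delta != 0 -> polyhedron P ->
  (lebesgue_tuple n).-negligible
    [set t | P (ball_point u t) /\ ~ interior P (ball_point u t)].
Proof.
move=> delta0 [p [C [c ->]]].
pose F (r : 'I_p) : set (n.-tuple mR) :=
  [set t | (exists j, C r j != 0) /\ (C *m ball_point u t) r 0 = c r 0].
apply: (@negligibleS _ _ _ _ (\bigcup_r F r)); last first.
  apply: negligible_bigcup_ord => r.
  have [[j Crj]|Cr0] := pselect (exists j, C r j != 0); last first.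
    by apply: (@negligibleS _ _ _ _ set0); [move=> t []|exact: negligible_set0].
  apply: (@negligibleS _ _ _ _ [set t : n.-tuple mR |
      \sum_j (delta * C r j) * tnth t j + ((C *m u) r 0 - c r 0) = 0]).
    move=> t [_]; rewrite /= mulmx_ball_point => <-.
    by rewrite addrA subrr.
  apply/negligibleP; first exact: measurable_hyperplane.
  by apply: lebesgue_tuple_hyperplane; exists j; rewrite mulf_neq0.
move=> t /= [Pt]; set q := ball_point u t in Pt *; apply: contra_notP => nF.
apply: (@filter_forall _ _ (fun r v => (C *m v) r 0 <= c r 0) (nbhs q) _) => r.
have [Cr|Cr0] := pselect (exists j, C r j != 0).
  have Cq : (C *m q) r 0 < c r 0.
    by rewrite lt_neqAle Pt andbT; apply/eqP => Ceq; apply: nF; exists r.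
  have Ccont : {for q, continuous (fun v => (C *m v) r 0)}.
    apply: (@cvg_comp _ _ _ (mulmx C) (fun v : 'cV[R]_p => v r 0)).
      exact: mulmx_continuous.
    exact: coord_continuous.
  exact: (cvgr_le _ Ccont).
apply: nearW => v; have C0 (w : 'cV[R]_n) : (C *m w) r 0 = 0.
  rewrite mxE big1// => j _.
  have -> : C r j = 0 by apply/eqP/negPn/negP => Crj; apply: Cr0; exists j.
  by rewrite mul0r.
by rewrite C0 -(C0 q) Pt.
Qed.

Lemma ball_point_eball u t : 0 <= delta -> ball_tuple t ->
  eball u delta (ball_point u t).
Proof.
rewrite /ball_tuple /eball /= subr0 => d0 t1.
by rewrite /ball_point addrC addKr enormZ ger0_norm// ler_piMr.
Qed.

Lemma ball_pointD h u t : ball_point (h + u) t = h + ball_point u t.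
Proof. by rewrite /ball_point addrA. Qed.

End ball_points.

Section smoothing_cells.
Context {R : realType}.
Local Notation mR := (measurableTypeR R).
Variables (n m k : nat) (U : set 'cV[R]_n) (y : 'cV[R]_n -> 'cV[R]_m).
Variables (cell : 'I_k -> set 'cV[R]_n) (A : 'I_k -> 'M[R]_(m, n)).
Variable b : 'I_k -> 'cV[R]_m.
Hypothesis U_open : open U.
Hypothesis y_pwa : continuous_piecewise_affine U y cell A b.
Hypothesis y_loclip : locally_lipschitz U y.

(** Otherwise interior points of [cell j] tending to [q] would enter the interior of [cell i],
    against disjointness. *)
Lemma interior_cell_uniq i j q : U q -> interior (cell i) q -> cell j q -> j = i.
Proof.
move=> Uq iq jq; apply/eqP/negPn/negP => ij.
have [u [Uu uq]] := interior_cell_seq U_open y_pwa Uq jq.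
have ui : \forall l \near \oo, interior (cell i) (u l).
  by apply: uq; apply: open_nbhs_nbhs; split => //; exact: open_interior.
have [l il] := filter_ex ui.
have [[_ _ disj _] _ _] := y_pwa.
suff : (interior (cell j) `&` interior (cell i)) (u l) by rewrite disj.
by split => //; case: (Uu l).
Qed.

(* The Lipschitz constant takes part in the compactness argument through the
   filter [+oo], as the constants of [y_loclip] depend on the point. *)
Lemma uniform_lipschitz_near (K : set 'cV[R]_n) : compact K -> K `<=` U ->
  exists L : R, \forall h \near (0 : 'cV[R]_n), forall p, K p ->
    [/\ U (h + p), `|y (h + p)| <= L & `|y (h + p) - y p| <= L * `|h|].
Proof.
move=> /compact_near_coveringP Kcov KU.
pose P (i : R * 'cV[R]_n) p :=
  [/\ U (i.2 + p), `|y (i.2 + p)| <= i.1 & `|y (i.2 + p) - y p| <= i.1 * `|i.2|].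
have : \forall i \near filter_prod (pinfty_nbhs R) (nbhs (0 : 'cV[R]_n)), K `<=` P i.
  apply: Kcov => p Kp.
  have [l [V [Vp lip]]] := y_loclip (KU _ Kp).
  have yp : {for p, continuous y} by case: y_pwa => _ + _; apply; exact: KU.
  have Up : nbhs p U by apply: open_nbhs_nbhs; split => //; exact: KU.
  have bp : \forall q \near p, `|y q| <= `|y p| + 1.
    have /cvgrPdist_lt/(_ 1 ltr01) := yp; apply: filterS => q; rewrite distrC => yqp.
    by rewrite -lerBlDl (le_trans (lerB_dist _ _))// ltW.
  have /nbhs_ballP[r /= r0 rW] : nbhs p (V `&` U `&` [set q | `|y q| <= `|y p| + 1]).
    by apply: filterI => //; exact: filterI.
  have small_h : \forall h \near (0 : 'cV[R]_n), `|h| < r / 2.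
    by apply: nbhs0_lt; rewrite divr_gt0.
  (* The first term converts the Euclidean Lipschitz bound to the sup norm; the second bounds [y]
     near [p]. The radius [r / 2] keeps both [q] and [h + q] in the ball of radius [r]. *)
  pose L0 := Num.max (`|l| * n%:R) (`|y p| + 1).
  exists (ball p (r / 2), [set i | L0 <= i.1 /\ `|i.2| < r / 2]) => /=.
    split; first by apply: nbhsx_ballx; rewrite divr_gt0.
    exists ([set L | L0 <= L], [set h | `|h| < r / 2]) => /=.
      by split; [by apply: nbhs_pinfty_ge; exact: num_real|exact: small_h].
    by move=> [].
  move=> [q [L h]] /= [pq [LL0 hr]].
  have [|[Vq Uq] _] := rW q.
    by apply: le_ball pq; rewrite ler_pdivrMr// ler_peMr ?ltW// ltr1n.
  have [|[Vh Uh] yh] := rW (h + q).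
    rewrite -ball_normE /= opprD addrCA (le_lt_trans (ler_normD _ _))//.
    rewrite normrN (splitr r) ltrD//.
    by rewrite -ball_normE in pq.
  move: LL0; rewrite ge_max => /andP[L1 L2].
  split => //=; first exact: le_trans yh L2.
  rewrite (le_trans (norm_le_enorm _))// (le_trans (lip _ _ _ _))// addrK.
  apply: (@le_trans _ _ (`|l| * (n%:R * `|h|))).
    apply: (@le_trans _ _ (`|l| * enorm h)).
      by rewrite ler_wpM2r ?enorm_ge0 ?ler_norm.
    by rewrite ler_wpM2l// enorm_le_norm.
  by rewrite mulrA ler_wpM2r.
move=> [[S W] [/= [M [_ MS]] W0] SW].
(* Any constant beyond the threshold [M] of the filter [+oo] is admissible. *)
exists (M + 1); apply: filterS W0 => h Wh p Kp.
have := SW (M + 1, h); rewrite /P /=; apply => //.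
by split => //; apply: MS; rewrite ltrDl.
Qed.

Variables (delta : R).
Local Notation ball_point := (ball_point delta).

(* Points lying in several cells are given to the cell of smallest index: the
   pieces then partition the unit ball exactly, not just up to a null set. *)
Definition piece u (j : 'I_k) : set (n.-tuple mR) :=
  [set t | [/\ ball_tuple t, cell j (ball_point u t) &
    forall i : 'I_k, (i < j)%N -> ~ cell i (ball_point u t)]].

Lemma measurable_piece u j : measurable (piece u j).
Proof.
have mC i : measurable [set t | cell i (ball_point u t)].
  exact: measurable_polyhedron_ball_point (cell_polyhedron y_pwa i).
rewrite (_ : piece u j = @ball_tuple R n `&` [set t | cell j (ball_point u t)] `&`
    \bigcap_(i in [set i : 'I_k | (i < j)%N]) ~` [set t | cell i (ball_point u t)]).
  apply: measurableI; first by apply: measurableI => //; exact: measurable_ball_tuple.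
  by apply: fin_bigcap_measurable => // i _; exact: measurableC.
by apply/seteqP; split=> t [] => [Bt jt ij|[Bt jt] ij]; split.
Qed.

Lemma piece_cover u t : U (ball_point u t) -> ball_tuple t ->
  exists j, piece u j t.
Proof.
move=> Uq Bt; have [i0 i0q] := cell_cover y_pwa Uq.
case: (@arg_minnP _ i0 (fun i => `[< cell i (ball_point u t) >]) val).
  exact/asboolP.
move=> j /asboolP jq jmin; exists j; split => // i ij /asboolP /jmin.
by rewrite leqNgt ij.
Qed.

Lemma piece_uniq u t i j : piece u i t -> piece u j t -> i = j.
Proof.
move=> [_ it imin] [_ jt jmin].
have [ij|ji|/val_inj//] := ltngtP i j; first by case: (jmin i ij it).
by case: (imin j ji jt).
Qed.

Lemma sum_piece u t j (c : 'I_k -> R) : piece u j t ->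
  \sum_i c i * \1_(piece u i) t = c j.
Proof.
move=> jt; rewrite (bigD1 j)//= big1 ?addr0 => [|i ij].
  by rewrite indicE mem_set// mulr1.
rewrite indicE memNset ?mulr0// => it.
by move: ij; rewrite (piece_uniq it jt) eqxx.
Qed.

(** On the unit ball the function equals a finite sum of affine functions cut off by the indicators
    of the measurable pieces. *)
Lemma measurable_fun_ball_point u i : 0 <= delta -> eball u delta `<=` U ->
  measurable_fun (@ball_tuple R n) (fun t => y (ball_point u t) i 0).
Proof.
move=> d0 uU.
apply: (@eq_measurable_fun _ _ _ _ _ (fun t => \sum_j
    ((A j *m ball_point u t) i 0 + b j i 0) * \1_(piece u j) t)).
  move=> t; rewrite inE => Bt.
  have Uq := uU _ (ball_point_eball u d0 Bt).
  have [j jt] := piece_cover Uq Bt.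
  rewrite (sum_piece _ jt); have [_ _ yE] := y_pwa.
  by case: jt => _ jq _; rewrite (yE j)// [RHS]mxE.
apply: measurable_sum => j; apply: measurable_funTS.
apply: measurable_funM.
  apply: measurable_funD; first exact: measurable_mulmx_ball_point.
  exact: measurable_cst.
by apply: measurable_indic; exact: measurable_piece.
Qed.

End smoothing_cells.

(** * Differentiability of the smoothing *)

Section smoothing_derivative.
Context {R : realType}.
Local Notation mR := (measurableTypeR R).
Variables (n m k : nat) (U : set 'cV[R]_n) (y : 'cV[R]_n -> 'cV[R]_m).
Variables (cell : 'I_k -> set 'cV[R]_n) (A : 'I_k -> 'M[R]_(m, n)).
Variable b : 'I_k -> 'cV[R]_m.
Hypothesis U_open : open U.
Hypothesis y_pwa : continuous_piecewise_affine U y cell A b.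
Hypothesis y_loclip : locally_lipschitz U y.
Variables (delta : R) (x : 'cV[R]_n).
Hypothesis delta_gt0 : 0 < delta.
Hypothesis xU : eball x delta `<=` U.
Let mu := lebesgue_tuple n : {sigma_finite_measure set (n.-tuple mR) -> \bar R}.
Let B := @ball_tuple R n.
Local Notation ball_point := (ball_point delta).
Local Notation piece := (piece cell delta x).

Definition cell_weight j : R := (fine (mu B))^-1 * fine (mu (piece j)).

Let mB : measurable B. Proof. exact: measurable_ball_tuple. Qed.

Let B_fin : (mu B < +oo)%E. Proof. exact: ball_tuple_finite. Qed.

Let B_gt0 : 0 < fine (mu B).
Proof. by apply: fine_gt0; rewrite B_fin andbT; exact: ball_tuple_gt0. Qed.

Let mpiece j : measurable (piece j).
Proof. exact: (measurable_piece y_pwa). Qed.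

Let piece_ball j : piece j `<=` B. Proof. by move=> t []. Qed.

Let ball_piece t : B t -> exists j, piece j t.
Proof.
move=> Bt; apply: (piece_cover y_pwa) => //.
by apply: xU; apply: ball_point_eball => //; exact: ltW.
Qed.

Lemma cell_weight_ge0 j : 0 <= cell_weight j.
Proof. by rewrite mulr_ge0 ?invr_ge0 ?fine_ge0. Qed.

Lemma sum_cell_weight : \sum_j cell_weight j = 1.
Proof.
rewrite -mulr_sumr; under eq_bigr do rewrite -[fine _]mul1r.
rewrite -(@Rintegral_sum_indic _ _ _ mu B mB B_fin _ _ (fun=> 1)) //.
rewrite (@eq_Rintegral _ _ _ _ _ (cst 1)) => [|t].
  by rewrite /= Rintegral_cst// mul1r mulVf// gt_eqF.
by rewrite inE => /ball_piece[j jt]; rewrite (sum_piece _ jt).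
Qed.

Lemma cell_weight_active j : 0 < cell_weight j -> ball_active cell x delta j.
Proof.
have [[t [Bt jt _]] _|pj0] := pselect (piece j !=set0).
  exists (ball_point x t); split => //.
  by apply: ball_point_eball => //; exact: ltW.
move/set0P/negP/negPn/eqP : pj0 => pj0.
by rewrite /cell_weight pj0 measure0 mulr0 ltxx.
Qed.

Lemma Jac_smoothing :
  differentiable (smoothing delta y) x /\
  Jac (smoothing delta y) x = \sum_j cell_weight j *: A j.
Proof.
have [L near_xU] := uniform_lipschitz_near U_open y_pwa y_loclip
  (@compact_eball _ _ x delta) xU.
have ball_x t : B t -> eball x delta (ball_point x t).
  by move=> Bt; apply: ball_point_eball => //; exact: ltW.
have near_measurable i : \forall h \near (0 : 'cV[R]_n),
    measurable_fun B (fun t => y (ball_point (h + x) t) i 0).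
  apply: filterS near_xU => h hU.
  apply: (measurable_fun_ball_point y_pwa); first exact: ltW.
  move=> s xs; rewrite -(subrK h s) addrC.
  have [|//] := hU (s - h).
  by move: xs; rewrite /eball /= opprD addrA.
have near_integrable i : \forall h \near (0 : 'cV[R]_n),
    mu.-integrable B (EFin \o (fun t => y (ball_point (h + x) t) i 0)).
  apply: filterS2 (near_measurable i) near_xU => h mh hU.
  apply: measurable_bounded_integrable => //.
  exists L; split; first exact: num_real.
  move=> M LM t Bt; apply: le_trans (ltW LM); apply: le_trans (mx_entry_le _ _ _) _.
  by rewrite ball_pointD; have [] := hU _ (ball_x _ Bt).
have integrable_x i : mu.-integrable B (EFin \o (fun t => y (ball_point x t) i 0)).
  by have := nbhs_singleton (near_integrable i); rewrite add0r.
(* [G i h t] is the linearization error at one sample [t]; the error of the smoothing is its mean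
   over the ball. *)
pose G i h t := y (ball_point (h + x) t) i 0 - y (ball_point x t) i 0 -
  \sum_j (A j *m h) i 0 * \1_(piece j) t.
have int_G i : \forall h \near (0 : 'cV[R]_n),
    (smoothing delta y (h + x) - smoothing delta y x -
      (\sum_j cell_weight j *: A j) *m h) i 0 =
    (fine (mu B))^-1 * \int[mu]_(t in B) G i h t.
  apply: filterS (near_integrable i) => h int_h.
  rewrite /G RintegralB//; last 2 first.
  - exact: (integrableB _ int_h (integrable_x i)).
  - exact: integrable_sum_indic.
  rewrite RintegralB// Rintegral_sum_indic// mulmx_suml.
  rewrite !mxE !summxE !mulrBr mulr_sumr; congr (_ - _).
  apply: eq_bigr => j _.
  by rewrite -scalemxAl !mxE /cell_weight -mulrA [fine _ * _]mulrC.
have small_G i e : 0 < e -> \forall h \near (0 : 'cV[R]_n),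
    `|\int[mu]_(t in B) G i h t| <= e * `|h|.
  (* [L] controls the increment of [y]; the sum controls the linear part, whichever piece contains
     [t]. *)
  move: e; apply: (@Rintegral_littleo _ _ _ mu B mB B_fin _ _
      (L + \sum_j n%:R * `|A j|)).
  - apply: filterS (near_measurable i) => h mh.
    apply: measurable_funB; last first.
      apply: measurable_sum => j; apply: measurable_funM; first exact: measurable_cst.
      by apply: measurable_funTS; exact: measurable_indic.
    apply: measurable_funB => //.
    by have := nbhs_singleton (near_measurable i); rewrite add0r.
  - apply: filterS near_xU => h hU t Bt; rewrite mulrDl.
    apply: le_trans (ler_normB _ _) _; apply: lerD.
      have [_ _] := hU _ (ball_x _ Bt); apply: le_trans.
      rewrite ball_pointD; set q := ball_point x t.
      by have := mx_entry_le (y (h + q) - y q) i 0; rewrite !mxE.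
    have [j jt] := ball_piece Bt; rewrite (sum_piece _ jt).
    apply: le_trans (mx_entry_le _ _ _) _; apply: le_trans (mulmx_norm_le _ _) _.
    rewrite ler_wpM2r// (bigD1 j)//= lerDl.
    by apply: sumr_ge0 => l _; exact: mulr_ge0.
  (* Off the frontiers, [y] is affine near the sampled point, so the error vanishes for all small
     [h]. *)
  have := negligible_bigcup_ord (fun j => polyhedron_frontier_negligible x
    (lt0r_neq0 delta_gt0) (cell_polyhedron y_pwa j)).
  apply: negligibleS => t /= nG; apply: contrapT => nF; apply: nG => Bt.
  have [j jt] := ball_piece Bt; set q := ball_point x t.
  have Uq : U q by apply: xU; exact: ball_x.
  have jq : interior (cell j) q.
    apply: contrapT => njq; apply: nF; exists j => //.
    by case: jt.
  have yq : \forall p \near q, y p = A j *m p + b j.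
    by apply: filterS2 (near_cell_affine U_open y_pwa j Uq) jq => p; apply.
  apply: filterS (near_shift0 yq) => h yh.
  rewrite /G (sum_piece _ jt) ball_pointD yh (nbhs_singleton yq) mulmxDr.
  by move: (A j *m h) (A j *m q) => u v; rewrite !mxE; ring.
apply: Jac_eps => e e0.
(* The factor [fine (mu B)] in the tolerance cancels the normalization of the mean. *)
have near_all : \forall h \near (0 : 'cV[R]_n), forall i,
    `|\int[mu]_(t in B) G i h t| <= (e * fine (mu B)) * `|h|.
  apply: (@filter_forall _ _ _ (nbhs (0 : 'cV[R]_n)) _) => i.
  by apply: small_G; exact: mulr_gt0.
have near_int : \forall h \near (0 : 'cV[R]_n), forall i,
    (smoothing delta y (h + x) - smoothing delta y x -
      (\sum_j cell_weight j *: A j) *m h) i 0 =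
    (fine (mu B))^-1 * \int[mu]_(t in B) G i h t.
  by apply: (@filter_forall _ _ _ (nbhs (0 : 'cV[R]_n)) _) => i; exact: int_G.
apply: filterS2 near_all near_int => h Gh hE.
apply: mx_norm_le => [|i l]; first by rewrite mulr_ge0// ltW.
rewrite (ord1 l) hE normrM ger0_norm ?invr_ge0 ?(ltW B_gt0)//.
by rewrite mulrC ler_pdivrMr// mulrAC Gh.
Qed.

End smoothing_derivative.

Lemma interior_of_dist (R : realType) n (S : set 'cV[R]_n) x p (delta : R) :
  (delta%:E < dist (@enorm R n) x (~` S))%E -> eball x delta p ->
  interior S p.
Proof.
move=> dist_gt xp.
(* The radius is the distance itself when finite; if it is [+oo], any radius beyond [delta] will
   do. *)
have [r xpr r_dist] : exists2 r : R, enorm (p - x) < r &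
    (r%:E <= dist (@enorm R n) x (~` S))%E.
  move: dist_gt; case: (dist _ _ _) => [r||]//; rewrite ?lte_fin.
    by exists r => //; exact: le_lt_trans dist_gt.
  by move=> _; exists (delta + 1); rewrite ?leey// (le_lt_trans xp)// ltrDl.
have : \forall q \near p, enorm (q - x) < r.
  exact: (cvgr_lt _ (@continuous_enormB _ _ x p)).
apply: filterS => q qr; apply: contrapT => nSq.
have : (dist (@enorm R n) x (~` S) <= (enorm (x - q))%:E)%E.
  by apply: ereal_inf_lbound; exists q.
move=> /(le_trans r_dist); rewrite lee_fin leNgt.
by rewrite -enormN opprB qr.
Qed.

(** Smoothing at [x] samples [y] on the whole ball, whence the condition [eball x delta]<=[U]: cells
    may extend beyond [U], where the affine formulas are not assumed. Differentiability is asserted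
    along with Jacobians and gradients because ['d] is meaningful only there. *)
Theorem corollary1 (R : realType) (n m : nat)
  (X NX : set 'cV[R]_n) (Y : set 'cV[R]_m)
  (g : 'cV[R]_n -> 'cV[R]_m -> R)
  (y : 'cV[R]_n -> 'cV[R]_m)
  (phi : 'cV[R]_n -> 'cV[R]_m -> R)
  (dbar Ly L1x L1y L2x L2y My : R)
  (X_neq0 : X !=set0) (X_convex : convex_set X) (X_compact : compact X)
  (NX_open : open NX) (X_NX : X `<=` NX)
  (y_argmin : forall x, NX x -> argmin_set Y (g x) = [set y x])
  (y_loclip : locally_lipschitz NX y)
  (dbar_gt0 : 0 < dbar)
  (Xdbar_NX : [set x + dbar *: v | x in X & v in eball 0 1] `<=` NX)
  (y_bounded : exists M : R, forall u,
     [set x + dbar *: v | x in X & v in eball 0 1] u -> enorm (y u) <= M)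
  (y_lipschitz : forall u v,
     [set x + dbar *: v | x in X & v in eball 0 1] u ->
     [set x + dbar *: v | x in X & v in eball 0 1] v ->
     enorm (y u - y v) <= Ly * enorm (u - v))
  (phi_C1 : C1 (fun p : 'cV[R]_n * 'cV[R]_m => phi p.1 p.2))
  (L1x_gt0 : 0 < L1x) (L1y_gt0 : 0 < L1y)
  (L2x_gt0 : 0 < L2x) (L2y_gt0 : 0 < L2y) (My_gt0 : 0 < My)
  (grad1_lipschitz : forall x x', X x -> X x' ->
     enorm (grad1 phi x (y x) - grad1 phi x' (y x')) <=
       L1x * enorm (x - x') + L1y * enorm (y x - y x'))
  (grad2_lipschitz : forall x x', X x -> X x' ->
     enorm (grad2 phi x (y x) - grad2 phi x' (y x')) <=
       L2x * enorm (x - x') + L2y * enorm (y x - y x'))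
  (grad2_bounded : forall x, X x -> enorm (grad2 phi x (y x)) <= My)
  (U : set 'cV[R]_n) (U_open : open U) (X_U : X `<=` U) (U_NX : U `<=` NX)
  (k : nat) (cell : 'I_k -> set 'cV[R]_n)
  (A : 'I_k -> 'M[R]_(m, n)) (b : 'I_k -> 'cV[R]_m)
  (y_pwa : continuous_piecewise_affine U y cell A b) :
  forall x, X x ->
  [/\ clarke_Jac y x = conv_hull [set A i | i in active cell x],

      forall delta, 0 < delta -> delta <= dbar -> eball x delta `<=` U ->
      [/\ differentiable (smoothing delta y) x,
          conv_hull [set A i | i in ball_active cell x delta]
            (Jac (smoothing delta y) x),
          [set d_x phi y x + w
             | w in conv_hull [set (A i)^T *m d_y phi y x
                         | i in ball_active cell x delta]]
            (hypergrad phi y delta x)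
        & ball_active cell x delta `<=` active cell x ->
          [/\ clarke_variation y x delta = 0%E,
              clarke_subdiff (phi_tilde phi y) x (hypergrad phi y delta x)
            & dist (@enorm R n) (hypergrad phi y delta x)
                (clarke_subdiff (phi_tilde phi y) x) = 0%E]]

    & forall i, interior (cell i) x ->
      differentiable (phi_tilde phi y) x /\
      forall delta, 0 < delta -> delta <= dbar -> eball x delta `<=` U ->
      (delta%:E < dist (@enorm R n) x (~` cell i))%E ->
      hypergrad phi y delta x = d_x phi y x + (A i)^T *m d_y phi y x /\
      d_x phi y x + (A i)^T *m d_y phi y x = grad (phi_tilde phi y) x].
Proof.
move=> x Xx.
have Ux := X_U _ Xx.
have y_loclipU : locally_lipschitz U y.
  move=> u /U_NX /y_loclip [L [V [Vu lip]]].
  exists L, V; split => // v w [Vv Uv] [Vw Uw].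
  by apply: lip; split => //; exact: U_NX.
have smooth delta : 0 < delta -> eball x delta `<=` U ->
    differentiable (smoothing delta y) x /\
    conv_hull [set A i | i in ball_active cell x delta] (Jac (smoothing delta y) x).
  move=> d0 xU; have [ds ->] := Jac_smoothing U_open y_pwa y_loclipU d0 xU.
  split => //; apply: conv_hull_sum.
  - exact: cell_weight_ge0.
  - exact: (sum_cell_weight y_pwa d0 xU).
  - by move=> j /(cell_weight_active d0) jx; exists j.
split.
- exact: (clarke_Jac_cells U_open y_pwa Ux).
- move=> delta d0 _ xU; have [ds Js] := smooth _ d0 xU; split => //.
    exists ((Jac (smoothing delta y) x)^T *m d_y phi y x) => //.
    rewrite -[X in conv_hull _ X]add0r.
    apply: (conv_hull_affine (trmx_mulmx_linear _) _ Js) => _ [i ix <-].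
    by exists i; rewrite ?add0r.
  move=> reg.
  have mem : clarke_subdiff (phi_tilde phi y) x (hypergrad phi y delta x).
    apply: (clarke_subdiff_cells U_open y_pwa phi_C1 Ux).
    by apply: conv_hull_mono Js => _ [i ix <-]; exists i => //; exact: reg.
  split => //; first exact: (clarke_variation_eq0 U_open y_pwa (ltW d0) xU).
  by apply: dist_eq0 => //; [exact: enorm_ge0|exact: enorm0].
- move=> i ix; have [dy Jy] := interior_cell_Jac U_open y_pwa Ux ix.
  have [dphi gphi] := diff_phi_tilde phi_C1 dy.
  split; first exact: dphi.
  move=> delta d0 _ xU dist_gt.
  split; last by rewrite gphi Jy.
  have [_ Js] := smooth _ d0 xU.
  (* Every cell that meets the ball is [cell i], so the hull containing the Jacobian reduces to
     [A i]. *)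
  suff JA : Jac (smoothing delta y) x = A i by rewrite /hypergrad JA.
  apply: conv_hull1 Js => _ [j [p [jp xp]] <-].
  have ip := interior_of_dist dist_gt xp.
  by rewrite (interior_cell_uniq U_open y_pwa (xU _ xp) ip jp).
Qed.
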